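(* Let $T=(A,B,\tau,\mathrm{res},\mathrm{tran},N)$ be a $\mathbb Z/2$-Tambara functor, $p$ an odd prime and $1\le m\le\infty$ an integer or infinity. Let $W_m(T;p)$ be the diagram consisting of the rings $W_m(A;p)$ and $W_m(B;p)$, the maps $W_m(\tau)\colon W_m(A;p)\to W_m(A;p)$ and $W_m(\mathrm{res})\colon W_m(B;p)\to W_m(A;p)$ induced by functoriality of Witt vectors in ring homomorphisms, the map $W_m(N)\colon W_m(A;p)\to W_m(B;p)$ induced by functoriality of $W_m(-;p)$ in multiplicative polynomial maps of degree less than $p$, and the map $\mathrm{tran}\colon W_m(A;p)\to W_m(B;p)$ defined by $\mathrm{tran}(x):=W_m(N)(x+1)-W_m(N)(x)-1$. Then $W_m(T;p)$ is a $\mathbb Z/2$-Tambara functor. It is the unique Tambara functor, functorial in $T$, with underlying rings $W_m(A;p)$ and $W_m(B;p)$, such that the ghost maps $w\colon W_m(A;p)\to\prod_mA$ and $w\colon W_m(B;p)\to\prod_mB$ define a natural morphism of Tambara functors from it to the $m$-fold product Tambara functor $\prod_mT$ (whose structure maps are those of $T$ in each coordinate).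
   Context: A $\mathbb Z/2$-Tambara functor $T$ consists of two commutative unital rings $A=T((\mathbb Z/2)/e)$ and $B=T((\mathbb Z/2)/(\mathbb Z/2))$, a unital ring involution $\tau\colon A\to A$, $a\mapsto\overline a$, and maps $\mathrm{res}\colon B\to A$, $\mathrm{tran}\colon A\to B$, $N\colon A\to B$ such that: $\mathrm{res}$ is a unital ring homomorphism with $\tau\,\mathrm{res}=\mathrm{res}$; $\mathrm{tran}$ is additive with $\mathrm{tran}\,\tau=\mathrm{tran}$, $\mathrm{res}\,\mathrm{tran}(a)=a+\overline a$ and $\mathrm{tran}(a\,\mathrm{res}(b))=\mathrm{tran}(a)b$; $N$ is multiplicative with $N(0)=0$, $N(1)=1$, $N\tau=N$, $\mathrm{res}\,N(a)=a\overline a$ and $N(a+b)=N(a)+N(b)+\mathrm{tran}(a\overline b)$. In particular $\mathrm{tran}(a)=N(a+1)-N(a)-1$, and $N$ is multiplicative and $2$-polynomial. A morphism of Tambara functors is a pair of unital ring homomorphisms commuting with all the structure maps. A function $f$ of abelian groups is $n$-polynomial if its $(n+1)$-st cross-effect $\sum_{U\subset\{1,\dots,n+1\}}(-1)^{n+1-|U|}f(\sum_{l\in U}a_l)$ vanishes identically. $W_m(A;p)$ is the ring of $p$-typical $m$-truncated Witt vectors: the set $\prod_{j=0}^{m-1}A$ (for $m=\infty$, $\prod_{j\geq0}A$) with the unique ring structure natural in $A$ for which the ghost map $w$ with components $w_j(a_0,a_1,\dots)=\sum_{i=0}^jp^ia_i^{p^{j-i}}$ is a ring homomorphism. For $n<p$,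 every multiplicative $n$-polynomial map $f\colon A\to B$ of commutative rings induces a multiplicative $n$-polynomial map $W_m(f)\colon W_m(A;p)\to W_m(B;p)$; the assignment $f\mapsto W_m(f)$ is the unique one extending the usual functoriality in ring homomorphisms, satisfying $W_m(g)W_m(f)=W_m(gf)$ whenever $f$ is $n$-polynomial, $g$ is $k$-polynomial and $nk<p$, and satisfying $w\circ W_m(f)=(\prod_mf)\circ w$. For $p$ odd this applies to $N$. *)

(* Defs.v *)
From HB Require Import structures.
From mathcomp Require Import all_boot all_order all_algebra.
From mathcomp Require Import all_classical.

Set Implicit Arguments.
Unset Strict Implicit.
Unset Printing Implicit Defensive.

Import GRing.Theory.
Local Open Scope ring_scope.

(* [comPzRingType] rather than [comNzRingType]: the zero ring is allowed. *)

Definition is_rmorphism (R S : pzRingType) (f : R -> S) : Prop :=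
  GRing.zmod_morphism f /\ GRing.monoid_morphism f.

Definition polynomial_map (n : nat) (U V : zmodType) (f : U -> V) : Prop :=
  forall a : 'I_n.+1 -> U,
    \sum_(S : {set 'I_n.+1})
      f (\sum_(l in S) a l) *~ ((-1) ^+ (n.+1 - #|S|)%N) = 0.

Definition mult_polynomial (n : nat) (R S : comPzRingType) (f : R -> S) :
    Prop :=
  GRing.monoid_morphism f /\ polynomial_map n f.

Record tambara_ops (A B : comPzRingType) : Type := TambaraOps {
  t_tau : A -> A;
  t_res : B -> A;
  t_tran : A -> B;
  t_norm : A -> B
}.

Record is_tambara (A B : comPzRingType) (O : tambara_ops A B) : Prop :=
  IsTambara {
  tau_rmorphism : is_rmorphism (t_tau O);
  tau_involutive : involutive (t_tau O);
  res_rmorphism : is_rmorphism (t_res O);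
  tau_res : forall b, t_tau O (t_res O b) = t_res O b;
  tran_additive : {morph t_tran O : a b / a + b};
  tran_tau : forall a, t_tran O (t_tau O a) = t_tran O a;
  res_tran : forall a, t_res O (t_tran O a) = a + t_tau O a;
  frobenius_reciprocity :
    forall a b, t_tran O (a * t_res O b) = t_tran O a * b;
  norm_mult : {morph t_norm O : a b / a * b};
  norm0 : t_norm O 0 = 0;
  norm1 : t_norm O 1 = 1;
  norm_tau : forall a, t_norm O (t_tau O a) = t_norm O a;
  res_norm : forall a, t_res O (t_norm O a) = a * t_tau O a;
  norm_add : forall a b,
    t_norm O (a + b) =
      t_norm O a + t_norm O b + t_tran O (a * t_tau O b)
}.

(* [t_und] is the value at (Z/2)/e and [t_fix] the value at (Z/2)/(Z/2). *)
Record tambara : Type := Tambara {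
  t_und : comPzRingType;
  t_fix : comPzRingType;
  t_ops :> tambara_ops t_und t_fix;
  t_axioms : is_tambara t_ops
}.

Record is_tambara_morphism (A B A' B' : comPzRingType)
    (O : tambara_ops A B) (O' : tambara_ops A' B')
    (f : A -> A') (g : B -> B') : Prop := IsTambaraMorphism {
  mor_und : is_rmorphism f;
  mor_fix : is_rmorphism g;
  mor_tau : forall a, f (t_tau O a) = t_tau O' (f a);
  mor_res : forall b, f (t_res O b) = t_res O' (g b);
  mor_tran : forall a, g (t_tran O a) = t_tran O' (f a);
  mor_norm : forall a, g (t_norm O a) = t_norm O' (f a)
}.

(* [None] stands for m = infinity. *)
Definition in_range (m : option nat) (j : nat) : bool :=
  if m is Some k then (j < k)%N else true.

Definition widx (m : option nat) : Type := {j : nat | in_range m j}.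

Definition vec (m : option nat) (A : Type) : Type := widx m -> A.

Definition vmap (m : option nat) (A B : Type) (f : A -> B) (a : vec m A) :
    vec m B :=
  fun j => f (a j).
Arguments vmap m {A B} f a _ /.

Definition prod_ring (m : option nat) (A : comPzRingType) : comPzRingType :=
  (widx m -> A : comPzRingType).

Definition prod_ops (m : option nat) (A B : comPzRingType)
    (O : tambara_ops A B) : tambara_ops (prod_ring m A) (prod_ring m B) :=
  {| t_tau := vmap m (t_tau O);
     t_res := vmap m (t_res O);
     t_tran := vmap m (t_tran O);
     t_norm := vmap m (t_norm O) |}.

Lemma vmap_rmorphism (m : option nat) (A B : comPzRingType) (f : A -> B) :
  is_rmorphism f ->
  is_rmorphism (vmap m f : prod_ring m A -> prod_ring m B).
Proof.
move=> [fB [f1 fM]]; split; last split.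
- by move=> x y; apply: funext => j; apply: fB.
- by apply: funext => j; apply: f1.
- by move=> x y; apply: funext => j; apply: fM.
Qed.

Lemma prod_is_tambara (m : option nat) (A B : comPzRingType)
    (O : tambara_ops A B) : is_tambara O -> is_tambara (prod_ops m O).
Proof.
case=> tau_rm tauK res_rm taures tranD trantau restran tranM normM n0 n1
  normtau resnorm normD.
by split; try exact: vmap_rmorphism;
  move=> *; apply: funext => j /=;
  [apply: tauK | apply: taures | apply: tranD | apply: trantau
  | apply: restran | apply: tranM | apply: normM | apply: n0 | apply: n1
  | apply: normtau | apply: resnorm | apply: normD].
Qed.

Definition tambara_prod (m : option nat) (T : tambara) : tambara :=
  Tambara (prod_is_tambara m (t_axioms T)).

(* [insubd j i] is the index [i] of [widx m]: as [i <= val j], it is in range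
   and the default [j] is never used. *)
Definition ghost (p : nat) (m : option nat) (A : comPzRingType)
    (a : vec m A) : vec m A :=
  fun j => \sum_(i < (val j).+1)
    a (insubd j (i : nat)) ^+ (p ^ (val j - i))%N *+ (p ^ i)%N.

Definition comring_structure (T : Type) : Type := GRing.ComPzRing.axioms_ T.

Definition comring_of (T : Type) (c : comring_structure T) : comPzRingType :=
  GRing.ComPzRing.Pack c.

(* The carrier is literally the product [vec m A]; the ring operations are
   determined by naturality and the ghost map. *)
Record witt_structure (p : nat) (m : option nat) : Type := WittStructure {
  witt_str : forall A : comPzRingType, comring_structure (vec m A);
  witt_natural : forall (A B : comPzRingType) (f : A -> B),
    is_rmorphism f ->
    is_rmorphism
      (vmap m f : comring_of (witt_str A) -> comring_of (witt_str B));
  witt_ghost : forall A : comPzRingType,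
    is_rmorphism (@ghost p m A : comring_of (witt_str A) -> prod_ring m A)
}.

Definition witt (p : nat) (m : option nat) (W : witt_structure p m)
    (A : comPzRingType) : comPzRingType :=
  comring_of (witt_str W A).

Definition witt_map (p : nat) (m : option nat) (W : witt_structure p m)
    (A B : comPzRingType) (f : A -> B) : witt W A -> witt W B :=
  vmap m f.

Definition witt_w (p : nat) (m : option nat) (W : witt_structure p m)
    (A : comPzRingType) : witt W A -> prod_ring m A :=
  @ghost p m A.

(* The extension of [witt_map] to multiplicative n-polynomial maps, n < p.
   Nothing is said about [wpoly f] for other maps [f]. *)
Record witt_poly_functoriality (p : nat) (m : option nat)
    (W : witt_structure p m) : Type := WittPolyFunctoriality {
  wpoly : forall A B : comPzRingType, (A -> B) -> witt W A -> witt W B;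
  wpoly_mult_polynomial : forall (n : nat) (A B : comPzRingType) (f : A -> B),
    (n < p)%N -> mult_polynomial n f -> mult_polynomial n (wpoly f);
  wpoly_rmorphism : forall (A B : comPzRingType) (f : A -> B),
    is_rmorphism f -> wpoly f =1 witt_map f;
  wpoly_comp : forall (n k : nat) (A B C : comPzRingType)
      (f : A -> B) (g : B -> C),
    (n < p)%N -> (k < p)%N -> (n * k < p)%N ->
    mult_polynomial n f -> mult_polynomial k g ->
    wpoly (g \o f) =1 wpoly g \o wpoly f;
  wpoly_ghost : forall (n : nat) (A B : comPzRingType) (f : A -> B),
    (n < p)%N -> mult_polynomial n f ->
    @witt_w p m W B \o wpoly f =1 vmap m f \o @witt_w p m W A
}.

Definition witt_tambara (p : nat) (m : option nat) (W : witt_structure p m)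
    (P : witt_poly_functoriality W) (T : tambara) :
    tambara_ops (witt W (t_und T)) (witt W (t_fix T)) :=
  {| t_tau := witt_map (t_tau T);
     t_res := witt_map (t_res T);
     t_tran := fun x : witt W (t_und T) =>
       wpoly P (t_norm T) (x + 1) - wpoly P (t_norm T) x - 1;
     t_norm := wpoly P (t_norm T) |}.

(* [F] is the object part of a functor from Tambara functors to Tambara
   functors, with underlying ring-valued functors [T |-> witt W (t_und T)] and
   [T |-> witt W (t_fix T)], such that the ghost maps are a natural morphism
   of Tambara functors from [F T] to the m-fold product of [T]. *)
Record is_ghost_functor (p : nat) (m : option nat) (W : witt_structure p m)
    (F : forall T : tambara, tambara_ops (witt W (t_und T)) (witt W (t_fix T)))
    : Prop := IsGhostFunctor {
  gf_tambara : forall T : tambara, is_tambara (F T);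
  gf_functorial : forall (T T' : tambara)
      (f : t_und T -> t_und T') (g : t_fix T -> t_fix T'),
    is_tambara_morphism T T' f g ->
    is_tambara_morphism (F T) (F T') (witt_map f) (witt_map g);
  gf_ghost : forall T : tambara,
    is_tambara_morphism (F T) (tambara_prod m T)
      (@witt_w p m W (t_und T)) (@witt_w p m W (t_fix T));
  gf_ghost_natural : forall (T T' : tambara)
      (f : t_und T -> t_und T') (g : t_fix T -> t_fix T'),
    is_tambara_morphism T T' f g ->
    @witt_w p m W (t_und T') \o witt_map f
      =1 vmap m f \o @witt_w p m W (t_und T) /\
    @witt_w p m W (t_fix T') \o witt_map g
      =1 vmap m g \o @witt_w p m W (t_fix T)
}.

(* Main.v *)
Require Import Defs.
From HB Require Import structures.
From mathcomp Require Import all_boot all_order all_algebra.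
From mathcomp Require Import boolp finmap.
From mathcomp.multinomials Require Import monalg.
From mathcomp Require Import ring.

Set Implicit Arguments.
Unset Strict Implicit.
Unset Printing Implicit Defensive.

Import GRing.Theory Num.Theory.
Local Open Scope ring_scope.

(** On rings without additive torsion the ghost map is injective, so there the
Tambara axioms for W_m(T; p), and the values of any competing structure, can be
read off from the product of copies of T: the ghost maps commute with all
structure maps ([witt_ghost_morphism]), and a structure that embeds in a Tambara
functor is a Tambara functor ([tambara_of_injective]).  For general T the ghost
map loses information, and the point is to reduce to the torsion-free case.

This reduction uses a cover: every Tambara functor T receives a morphism, onto
in both degrees, from a Tambara functor with torsion-free rings ([cover],
[cover_morphism]).  Witt vectors preserve surjections, and the maps W_m(f),
W_m(g) of a morphism (f, g) commute with all structure maps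
([witt_map_morphism]): for the norm this is the functoriality of W_m in
multiplicative polynomial maps, applied to the two sides of g o N = N o f, where
2 * 1 < p because p is odd.  Hence axioms descend from the cover to T
([tambara_of_surjective]), and so does uniqueness ([ghost_functor_unique]).

The cover of T = (A, B) is the Burnside-type Tambara functor freely generated by
the multiplicative monoids of A and B (each with a new unit adjoined, which does
no harm) and the maps tau, res and N between them.  Its underlying ring is the
monoid ring Z[A] with the induced involution tau.  The ring over the fixed
points has as additive basis the elements of B and the formal transfers of the
orbits of A; rather than multiplying basis elements, it is described by its
image in Z[A] x Z[B] under restriction and projection to geometric fixed points,
namely the subring of the pairs (x, y) for which x - Z[res](y) is a trace
z + tau z.  There
    res (x, y) = x,   tran a = (a + tau a, 0),   N a = (a * tau a, Z[N](a)),
and since the norm is additive on geometric fixed points, every axiom is an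
identity between ring expressions ([glue_is_tambara]).  The map to B sends
(x, y) to the value of y in B plus the transfer of the value of z in A.  The only
delicate point is that this does not depend on z, that is, that z + tau z = 0
forces the transfer to vanish; replacing each generator by a representative of
its orbit turns z + tau z into twice an element, and Z[A] has no 2-torsion
([cover_tran_eval_eq0]). *)

(** * Ring morphisms and Tambara functors *)

Definition rmorph_of (R S : pzRingType) (f : R -> S) (f_rm : is_rmorphism f) :
    {rmorphism R -> S} :=
  HB.pack f (GRing.isZmodMorphism.Build R S f f_rm.1)
    (GRing.isMonoidMorphism.Build R S f f_rm.2).

Lemma rmorphism_is_rmorphism (R S : pzRingType) (f : {rmorphism R -> S}) :
  is_rmorphism f.
Proof.
by split; [exact: raddfB | split; [exact: rmorph1 | exact: rmorphM]].
Qed.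

Section RMorphismTheory.
Variables (R S : pzRingType) (f : R -> S).
Hypothesis f_rm : is_rmorphism f.

Lemma is_rmorphism0 : f 0 = 0.
Proof. exact: (raddf0 (rmorph_of f_rm)). Qed.
Lemma is_rmorphismN : {morph f : x / - x}.
Proof. exact: (raddfN (rmorph_of f_rm)). Qed.
Lemma is_rmorphismD : {morph f : x y / x + y}.
Proof. exact: (raddfD (rmorph_of f_rm)). Qed.
Lemma is_rmorphismMn n : {morph f : x / x *+ n}.
Proof. exact: (raddfMn (rmorph_of f_rm)). Qed.
Lemma is_rmorphismX n : {morph f : x / x ^+ n}.
Proof. exact: (rmorphXn (rmorph_of f_rm)). Qed.

End RMorphismTheory.

Section TambaraTheory.
Variables (A B : comPzRingType) (O : tambara_ops A B).
Hypothesis O_tam : is_tambara O.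

Lemma tran_zmod_morphism : zmod_morphism (t_tran O).
Proof.
by move=> a b; apply/eqP; rewrite eq_sym subr_eq -(tran_additive O_tam) subrK.
Qed.

Lemma tran0 : t_tran O 0 = 0.
Proof. by rewrite -(subrr 0) tran_zmod_morphism subrr. Qed.

Lemma tranN a : t_tran O (- a) = - t_tran O a.
Proof. by rewrite -sub0r tran_zmod_morphism tran0 sub0r. Qed.

Lemma tran_norm a : t_tran O a = t_norm O (a + 1) - t_norm O a - 1.
Proof.
have [_ [tau1 _]] := tau_rmorphism O_tam.
rewrite (norm_add O_tam) (norm1 O_tam) tau1 mulr1.
by rewrite -addrA [_ + 1]addrC; ring.
Qed.

(** The value of [t_norm O] at [-1] is [t_tran O 1 - 1], not [-1]; additivity up
to a transfer, applied to [a + (- a) = 0], gives the general sign rule. *)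
Lemma norm_opp a : t_norm O (- a) = t_tran O (a * t_tau O a) - t_norm O a.
Proof.
have := norm_add O_tam a (- a).
rewrite (is_rmorphismN (tau_rmorphism O_tam)) subrr (norm0 O_tam) mulrN tranN.
move/eqP; rewrite eq_sym subr_eq0 => /eqP <-.
by ring.
Qed.

End TambaraTheory.

(** * Transport of Tambara structures along morphisms *)

(** All axioms are equations, so they can be tested after injective maps. *)
Lemma tambara_of_injective (A B A' B' : comPzRingType) (O : tambara_ops A B)
    (O' : tambara_ops A' B') (f : A -> A') (g : B -> B') :
  is_tambara_morphism O O' f g -> injective f -> injective g ->
  is_tambara O' -> is_tambara O.
Proof.
case=> f_rm g_rm ftau fres gtran gnorm f_inj g_inj.
case=> [[tauB [tau1 tauM]] tauK [resB [res1 resM]] taures tranD trantau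
  restran tranM normM n0 n1 normtau resnorm normD].
have fB := f_rm.1; have [f1 fM] := f_rm.2.
have gB := g_rm.1; have [g1 gM] := g_rm.2.
have f0 := is_rmorphism0 f_rm; have g0 := is_rmorphism0 g_rm.
have fD := is_rmorphismD f_rm; have gD := is_rmorphismD g_rm.
by split; [split; [|split] | | split; [|split] | | | | | | | | | | | ];
  move=> *; (apply: f_inj || apply: g_inj);
  rewrite ?(ftau, fres, gtran, gnorm, fB, f1, fM, gB, g1, gM, fD, gD, f0, g0,
    tauB, tau1, tauM, tauK, resB, res1, resM, taures, tranD, trantau, restran,
    tranM, normM, n0, n1, normtau, resnorm, normD).
Qed.

Lemma tambara_of_surjective (A B A' B' : comPzRingType) (O : tambara_ops A B)
    (O' : tambara_ops A' B') (f : A -> A') (g : B -> B') :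
  is_tambara_morphism O O' f g ->
  (forall a', exists a, f a = a') -> (forall b', exists b, g b = b') ->
  is_tambara O -> is_tambara O'.
Proof.
case=> f_rm g_rm ftau fres gtran gnorm f_surj g_surj.
case=> [[tauB [tau1 tauM]] tauK [resB [res1 resM]] taures tranD trantau
  restran tranM normM n0 n1 normtau resnorm normD].
have fB := f_rm.1; have [f1 fM] := f_rm.2.
have gB := g_rm.1; have [g1 gM] := g_rm.2.
have fD := is_rmorphismD f_rm; have gD := is_rmorphismD g_rm.
have f0 := is_rmorphism0 f_rm; have g0 := is_rmorphism0 g_rm.
split; [split; [|split] | | split; [|split] | | | | | | | | | | | ].
- move=> x y; case: (f_surj x) (f_surj y) => a <- [b <-].
  by rewrite -fB -!ftau tauB fB.
- by rewrite -f1 -ftau tau1.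
- move=> x y; case: (f_surj x) (f_surj y) => a <- [b <-].
  by rewrite -fM -!ftau tauM fM.
- by move=> x; have [a <-] := f_surj x; rewrite -!ftau tauK.
- move=> x y; case: (g_surj x) (g_surj y) => a <- [b <-].
  by rewrite -gB -!fres resB fB.
- by rewrite -g1 -fres res1.
- move=> x y; case: (g_surj x) (g_surj y) => a <- [b <-].
  by rewrite -gM -!fres resM fM.
- by move=> y; have [b <-] := g_surj y; rewrite -fres -ftau taures.
- move=> x y; case: (f_surj x) (f_surj y) => a <- [b <-].
  by rewrite -fD -!gtran tranD gD.
- by move=> x; have [a <-] := f_surj x; rewrite -ftau -!gtran trantau.
- by move=> x; have [a <-] := f_surj x; rewrite -gtran -fres restran fD ftau.
- move=> x y; case: (f_surj x) (g_surj y) => a <- [b <-].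
  by rewrite -fres -fM -!gtran tranM gM.
- move=> x y; case: (f_surj x) (f_surj y) => a <- [b <-].
  by rewrite -fM -!gnorm normM gM.
- by rewrite -f0 -gnorm n0.
- by rewrite -f1 -gnorm n1.
- by move=> x; have [a <-] := f_surj x; rewrite -ftau -!gnorm normtau.
- by move=> x; have [a <-] := f_surj x; rewrite -gnorm -fres resnorm fM ftau.
- move=> x y; case: (f_surj x) (f_surj y) => a <- [b <-].
  by rewrite -fD -ftau -fM -!gnorm -gtran normD !gD.
Qed.

Lemma ops_eq (A B : comPzRingType) (O O' : tambara_ops A B) :
  t_tau O =1 t_tau O' -> t_res O =1 t_res O' -> t_tran O =1 t_tran O' ->
  t_norm O =1 t_norm O' -> O = O'.
Proof.
case: O O' => [a b c d] [a' b' c' d'] /=.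
by move=> /funext-> /funext-> /funext-> /funext->.
Qed.

Lemma ops_eq_of_injective (A B A' B' : comPzRingType) (O1 O2 : tambara_ops A B)
    (O' : tambara_ops A' B') (f : A -> A') (g : B -> B') :
  is_tambara_morphism O1 O' f g -> is_tambara_morphism O2 O' f g ->
  injective f -> injective g -> O1 = O2.
Proof.
case=> _ _ tau1 res1 tran1 norm1 [_ _ tau2 res2 tran2 norm2] f_inj g_inj.
apply: ops_eq => x; (apply: f_inj || apply: g_inj).
- by rewrite tau1 tau2.
- by rewrite res1 res2.
- by rewrite tran1 tran2.
- by rewrite norm1 norm2.
Qed.

Lemma ops_eq_of_surjective (A B A' B' : comPzRingType) (O : tambara_ops A B)
    (O1 O2 : tambara_ops A' B') (f : A -> A') (g : B -> B') :
  is_tambara_morphism O O1 f g -> is_tambara_morphism O O2 f g ->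
  (forall a', exists a, f a = a') -> (forall b', exists b, g b = b') ->
  O1 = O2.
Proof.
case=> _ _ tau1 res1 tran1 norm1 [_ _ tau2 res2 tran2 norm2] f_surj g_surj.
apply: ops_eq => x.
- by have [a <-] := f_surj x; rewrite -tau1 tau2.
- by have [b <-] := g_surj x; rewrite -res1 res2.
- by have [a <-] := f_surj x; rewrite -tran1 tran2.
- by have [a <-] := f_surj x; rewrite -norm1 norm2.
Qed.

(** * Polynomial maps *)

Lemma sum_sets_ordS (V : nmodType) (n : nat) (F : {set 'I_n.+1} -> V) :
  \sum_S F S =
    \sum_(S : {set 'I_n})
      (F (lift ord0 @: S) + F (ord0 |: lift ord0 @: S)).
Proof.
have lift0 (S : {set 'I_n}) : (ord0 \in lift ord0 @: S) = false.
  by apply/imsetP => -[i _ /eqP]; rewrite (negPf (neq_lift _ _)).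
have liftS (S : {set 'I_n}) i : (lift ord0 i \in lift ord0 @: S) = (i \in S).
  exact/mem_imset/lift_inj.
rewrite (bigID (fun S : {set 'I_n.+1} => ord0 \in S)) /= addrC big_split /=.
pose drop (S : {set 'I_n.+1}) := [set i | lift ord0 i \in S].
congr (_ + _).
- rewrite (reindex (fun S : {set 'I_n} => lift ord0 @: S)) /=.
    by apply: eq_bigl => S; rewrite lift0.
  exists drop => S; rewrite inE.
  + by move=> _; apply/setP => i; rewrite inE liftS.
  + move=> S0; apply/setP => i; case: (unliftP ord0 i) => [j|] ->.
      by rewrite liftS inE.
    by rewrite lift0 (negPf S0).
- rewrite (reindex (fun S : {set 'I_n} => ord0 |: lift ord0 @: S)) /=.
    by apply: eq_bigl => S; rewrite setU11.
  exists drop => S; rewrite inE.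
  + move=> _; apply/setP => i.
    by rewrite !inE liftS eq_sym (negPf (neq_lift _ _)).
  + move=> S0; apply/setP => i; case: (unliftP ord0 i) => [j|] ->.
      by rewrite !inE liftS inE.
    by rewrite setU11 S0.
Qed.

(** The cross-effect of [f] at [a] is the cross-effect, with one variable less, of
the difference function [fun x => f (a ord0 + x) - f x].  This is the recursion
behind the inductive degree bounds below. *)
Lemma polynomial_map_sum_ordS (U V : zmodType) (f : U -> V) (n : nat)
    (a : 'I_n.+1 -> U) :
  \sum_(S : {set 'I_n.+1})
    f (\sum_(l in S) a l) *~ ((-1) ^+ (n.+1 - #|S|)%N) =
  \sum_(S : {set 'I_n})
    (f (a ord0 + \sum_(l in S) a (lift ord0 l))
      - f (\sum_(l in S) a (lift ord0 l))) *~ ((-1) ^+ (n - #|S|)%N).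
Proof.
rewrite sum_sets_ordS; apply: eq_bigr => S _.
have notin0 : ord0 \notin lift ord0 @: S.
  by apply/imsetP => -[i _ /eqP]; rewrite (negPf (neq_lift _ _)).
have cardS : (#|S| <= n)%N by rewrite -[X in (_ <= X)%N]card_ord max_card.
rewrite big_setU1 //= !big_imset; try by move=> ? ? _ _; apply: lift_inj.
rewrite cardsU1 notin0 card_imset; last exact: lift_inj.
by rewrite subSS subSn // exprS mulN1r mulrNz mulrzBl addrC.
Qed.

Lemma polynomial_map0 (U V : zmodType) (f : U -> V) :
  (forall a, f a = f 0) -> polynomial_map 0 f.
Proof.
move=> fc a; rewrite polynomial_map_sum_ordS big1 // => S _.
by rewrite fc [X in _ - X]fc subrr mul0rz.
Qed.

Lemma polynomial_mapS (U V : zmodType) (f : U -> V) (n : nat) :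
  (forall c, polynomial_map n (fun x => f (c + x) - f x)) ->
  polynomial_map n.+1 f.
Proof.
by move=> fP a; rewrite polynomial_map_sum_ordS; apply: (fP _ (a \o lift ord0)).
Qed.

Lemma rmorphism_mult_polynomial (R S : comPzRingType) (f : R -> S) :
  is_rmorphism f -> mult_polynomial 1 f.
Proof.
move=> f_rm; split; first exact: f_rm.2.
apply: polynomial_mapS => c; apply: polynomial_map0 => a.
by rewrite !(is_rmorphismD f_rm) !addrK.
Qed.

(** The first difference of the norm in the direction [c] is
[N c + tran (c * tau x)], affine in [x], so its second difference is constant. *)
Lemma norm_mult_polynomial (A B : comPzRingType) (O : tambara_ops A B) :
  is_tambara O -> mult_polynomial 2 (t_norm O).
Proof.
move=> O_tam; split.
  by split; [exact: norm1 | exact: norm_mult].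
apply: polynomial_mapS => c; apply: polynomial_mapS => d.
apply: polynomial_map0 => a.
have tauD := is_rmorphismD (tau_rmorphism O_tam).
have tau0 := is_rmorphism0 (tau_rmorphism O_tam).
rewrite !(norm_add O_tam) (norm0 O_tam) !tauD tau0 !(mulrDr, mulr0).
by rewrite !(tran_additive O_tam) (tran0 O_tam); ring.
Qed.

(** * The monoid ring over the integers *)

Definition torsion_free (V : zmodType) : Prop :=
  forall n (x : V), (0 < n)%N -> x *+ n = 0 -> x = 0.

Section LinearExtension.
Variables (K : choiceType) (V : zmodType) (h : K -> V).
Implicit Types g : {malg int[K]}.

(** The additive map out of the free abelian group on [K] that extends [h].  It is
available for any abelian group [V], and below for any commutative ring, the
zero ring included. *)
Definition zlift g : V := \sum_(k <- msupp g) h k *~ g@_k.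

Lemma zliftEw (d : {fset K}) g :
  (msupp g `<=` d)%fset -> zlift g = \sum_(k <- d) h k *~ g@_k.
Proof.
move=> le; rewrite /zlift (big_fset_incl _ le) //= => k _ /mcoeff_outdom ->.
by rewrite mulr0z.
Qed.

Lemma zlift_is_zmod_morphism : zmod_morphism zlift.
Proof.
move=> g1 g2; pose d := (msupp g1 `|` msupp g2)%fset.
rewrite (@zliftEw d (g1 - g2)) ?msuppB_le //.
rewrite (@zliftEw d g1) ?fsubsetUl // (@zliftEw d g2) ?fsubsetUr //.
by rewrite -sumrB; apply: eq_bigr => k _; rewrite mcoeffB mulrzBr.
Qed.

HB.instance Definition _ :=
  GRing.isZmodMorphism.Build {malg int[K]} V zlift zlift_is_zmod_morphism.

Lemma zliftU k : zlift << k >> = h k.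
Proof. by rewrite (zliftEw msuppU_le) big_seq_fset1 mcoeffUU. Qed.

End LinearExtension.

(** The generators span the free abelian group, so a property stable under
differences need only be checked on them. *)
Lemma malgZ_ind (K : choiceType) (P : {malg int[K]} -> Prop) :
  P 0 -> (forall k, P << k >>) -> (forall x y, P x -> P y -> P (x - y)) ->
  forall g, P g.
Proof.
move=> P0 PU PB.
have PN x : P x -> P (- x) by move=> Px; rewrite -sub0r; apply: PB.
have PD x y : P x -> P y -> P (x + y).
  by move=> Px Py; rewrite -[y]opprK; apply: PB => //; apply: PN.
move=> g; rewrite (monalgE g); apply: (big_ind P) => // k _.
have PM n : P (<< k >> *+ n).
  by elim: n => [|n IH]; rewrite ?mulr0n // mulrS; apply: PD.
case: (g@_k) => n.
- by rewrite -[Posz n]/(n%:Z) -natz monalgUMn.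
- by rewrite NegzE -natz monalgUN monalgUMn; apply: PN.
Qed.

Lemma eq_malgZ (K : choiceType) (V : zmodType) (f1 f2 : {malg int[K]} -> V) :
  zmod_morphism f1 -> zmod_morphism f2 ->
  (forall k, f1 << k >> = f2 << k >>) -> f1 =1 f2.
Proof.
move=> f1B f2B eqU; apply: malgZ_ind => // [|x y Ex Ey].
- by rewrite -(subrr 0) f1B f2B !subrr.
- by rewrite f1B f2B Ex Ey.
Qed.

Lemma malgUM (M : monomType) (x y : M) :
  << mmul x y >> = << x >> * << y >> :> {malg int[M]}.
Proof. by rewrite -[RHS]/(fgmul _ _) fgmulUU mulr1. Qed.

Lemma zlift_rmorphism (M : conomType) (R : comPzRingType) (h : M -> R) :
  h mone = 1 -> (forall x y, h (mmul x y) = h x * h y) ->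
  is_rmorphism (zlift h : ({malg int[M]} : comPzRingType) -> R).
Proof.
move=> h1 hM; split; first exact: zlift_is_zmod_morphism.
split; first exact: etrans (zliftU h _) h1.
move=> x y; elim/malgZ_ind: x => [|k|x1 x2 E1 E2].
- by rewrite mul0r raddf0 mul0r.
- elim/malgZ_ind: y => [|l|y1 y2 E1 E2].
  + by rewrite mulr0 raddf0 mulr0.
  + by rewrite -malgUM !zliftU.
  + by rewrite mulrBr !raddfB /= E1 E2 mulrBr.
- by rewrite mulrBl !raddfB /= E1 E2 mulrBl.
Qed.

Lemma malgZ_torsion_free (K : choiceType) : torsion_free {malg int[K]}.
Proof.
move=> n x n_gt0 xn0; apply/malgP => k; rewrite mcoeff0.
have /eqP := congr1 (mcoeff k) xn0.
by rewrite mcoeffMn mcoeff0 mulrn_eq0 eqn0Ngt n_gt0 => /eqP.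
Qed.

(** * Gluing a ring with involution to its geometric fixed points *)

(** The shape of a Tambara functor without transfers: [gd_geo] plays the role of
the geometric fixed points, the quotient of the ring of fixed points by the
image of the transfer.  Modulo transfers the norm is additive, whence the ring
morphism [gd_norm].  The restriction is a priori defined on this quotient only
modulo traces; [gd_res] is a multiplicative lift of it. *)
Record geometric_datum := GeometricDatum {
  gd_und : comPzRingType;
  gd_geo : comPzRingType;
  gd_tau : {rmorphism gd_und -> gd_und};
  gd_res : {rmorphism gd_geo -> gd_und};
  gd_norm : {rmorphism gd_und -> gd_geo};
  gd_tauK : involutive gd_tau;
  gd_tau_res : forall y, gd_tau (gd_res y) = gd_res y;
  gd_norm_tau : forall a, gd_norm (gd_tau a) = gd_norm a;
  gd_norm_trace : forall a, exists z,
    a * gd_tau a = gd_res (gd_norm a) + (z + gd_tau z)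
}.

Section Glue.
Variable D : geometric_datum.
Local Notation A := (gd_und D).
Local Notation C := (gd_geo D).
Local Notation tau := (@gd_tau D).
Local Notation rho := (@gd_res D).
Local Notation nu := (@gd_norm D).

Definition glue_pred : pred (A * C)%type :=
  fun u => `[< exists z, u.1 = rho u.2 + (z + tau z) >].

Lemma glue_predP (u : A * C) :
  reflect (exists z, u.1 = rho u.2 + (z + tau z)) (u \in glue_pred).
Proof. exact: asboolP. Qed.

Lemma tau_trace z : tau (z + tau z) = z + tau z.
Proof. by rewrite raddfD /= gd_tauK addrC. Qed.

Lemma tau_glue u : u \in glue_pred -> tau u.1 = u.1.
Proof.
by case/glue_predP => z ->; rewrite raddfD /= tau_trace gd_tau_res.
Qed.

(** Traces are stable under multiplication by elements fixed by [tau], and both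
components of a pair in [glue_pred] are fixed, the second through [rho]. *)
Lemma glue_subring_closed : subring_closed glue_pred.
Proof.
split.
- by apply/glue_predP; exists 0; rewrite /= !rmorph1 raddf0 !addr0.
- move=> u v /glue_predP[z Eu] /glue_predP[w Ev]; apply/glue_predP.
  by exists (z - w); rewrite /= Eu Ev !raddfB /=; ring.
- move=> u v /glue_predP[z Eu] Gv; have tv := tau_glue Gv.
  case/glue_predP: (Gv) => w Ev; apply/glue_predP.
  exists (z * v.1 + rho u.2 * w).
  rewrite /= !rmorphM raddfD /= !rmorphM tv gd_tau_res /= Eu.
  have -> : rho v.2 = v.1 - (w + tau w) by rewrite Ev addrK.
  by ring.
Qed.

Record glue : Type :=
  Glue { glue_val : (A * C)%type; glue_valP : glue_val \in glue_pred }.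
HB.instance Definition _ := [isSub for glue_val].
HB.instance Definition _ := [Choice of glue by <:].
HB.instance Definition _ :=
  GRing.SubChoice_isSubComPzRing.Build (A * C)%type glue_pred glue
    glue_subring_closed.

Lemma trace_glue a : (a + tau a, 0) \in glue_pred.
Proof. by apply/glue_predP; exists a; rewrite raddf0 add0r. Qed.

Lemma norm_glue a : (a * tau a, nu a) \in glue_pred.
Proof. exact/glue_predP/gd_norm_trace. Qed.

Definition glue_ops : tambara_ops A (glue : comPzRingType) := {|
  t_tau := tau;
  t_res := fun u : glue => (glue_val u).1;
  t_tran := fun a => Glue (trace_glue a);
  t_norm := fun a => Glue (norm_glue a)
|}.

Lemma glue_is_tambara : is_tambara glue_ops.
Proof.
split => /=.
- exact: rmorphism_is_rmorphism.
- exact: gd_tauK.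
- split; [|split] => //.
- by move=> u; apply: tau_glue (glue_valP u).
- move=> a b; apply: val_inj; congr (_, _); last by rewrite addr0.
  by rewrite raddfD /=; ring.
- by move=> a; apply: val_inj; rewrite /= gd_tauK addrC.
- by [].
- move=> a u; apply: val_inj; congr (_, _); last by rewrite /= mul0r.
  by rewrite /= rmorphM /= (tau_glue (glue_valP u)) mulrDl.
- move=> a b; apply: val_inj; congr (_, _); last by rewrite rmorphM.
  by rewrite /= rmorphM /=; ring.
- by apply: val_inj; rewrite /= mul0r raddf0.
- by apply: val_inj; rewrite /= !rmorph1 mulr1.
- by move=> a; apply: val_inj; rewrite /= gd_tauK gd_norm_tau mulrC.
- by [].
- move=> a b; apply: val_inj; congr (_, _) => /=; last by rewrite raddfD addr0.
  by rewrite raddfD rmorphM /= gd_tauK; ring.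
Qed.

Definition glue_tambara : tambara := Tambara glue_is_tambara.

End Glue.

Section GlueMorphism.
Variables (D : geometric_datum) (T : tambara).
Local Notation A := (gd_und D).
Local Notation C := (gd_geo D).
Local Notation tau := (@gd_tau D).
Local Notation rho := (@gd_res D).
Local Notation nu := (@gd_norm D).
Variables (f : {rmorphism A -> t_und T}) (g : {rmorphism C -> t_fix T}).
Hypothesis f_tau : forall a, f (tau a) = t_tau T (f a).
Hypothesis res_g : forall y, t_res T (g y) = f (rho y).
Hypothesis tran_f_eq0 : forall z, z + tau z = 0 -> t_tran T (f z) = 0.
Hypothesis norm_f : forall a, exists2 z,
  a * tau a = rho (nu a) + (z + tau z) &
  t_norm T (f a) = g (nu a) + t_tran T (f z).

(** The pair [(rho y + (z + tau z), y)] is the formal sum of a lift of [y] and of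
the transfer of [z]; this sum can be formed in [T].  [tran_f_eq0] makes the
result independent of [z], whence [glue_liftE]. *)
Definition glue_lift (u : glue D) : t_fix T :=
  g (glue_val u).2 + t_tran T (f (sval (cid (glue_predP _ (glue_valP u))))).

Lemma glue_liftE u z : (glue_val u).1 = rho (glue_val u).2 + (z + tau z) ->
  glue_lift u = g (glue_val u).2 + t_tran T (f z).
Proof.
rewrite /glue_lift; case: cid => w /= -> /addrI Ewz.
congr (_ + _); apply/eqP; rewrite -subr_eq0.
rewrite -(tran_zmod_morphism (t_axioms T)) -raddfB; apply/eqP/tran_f_eq0.
by rewrite raddfB /= addrACA Ewz -opprD subrr.
Qed.

Lemma glue_liftP u : exists2 z,
  (glue_val u).1 = rho (glue_val u).2 + (z + tau z) &
  glue_lift u = g (glue_val u).2 + t_tran T (f z).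
Proof.
have /glue_predP[z Ez] := glue_valP u.
by exists z => //; apply: glue_liftE.
Qed.

Lemma res_glue_lift u : t_res T (glue_lift u) = f (glue_val u).1.
Proof.
have [z -> ->] := glue_liftP u.
rewrite (is_rmorphismD (res_rmorphism (t_axioms T))).
by rewrite (res_tran (t_axioms T)) res_g !raddfD /= f_tau.
Qed.

(** Multiplicativity is Frobenius reciprocity applied twice, once for the transfer
of [f z] and once for that of [f w], as in the witness below. *)
Lemma glue_lift_morphism : is_tambara_morphism (glue_ops D) T f glue_lift.
Proof.
have T_tam := t_axioms T; have tranB := tran_zmod_morphism T_tam.
split => /=.
- exact: rmorphism_is_rmorphism.
- split; [|split].
  + move=> u v; have [z Ez ->] := glue_liftP u; have [w Ew ->] := glue_liftP v.
    rewrite (@glue_liftE _ (z - w)) /=; last first.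
      by rewrite Ez Ew !raddfB /=; ring.
    by rewrite !raddfB tranB /=; ring.
  + rewrite (@glue_liftE _ 0) /= ?rmorph1 ?raddf0 ?addr0 //.
    by rewrite (tran0 T_tam) addr0.
  + move=> u v; have Ev1 := res_glue_lift v.
    have [z Ez Eu] := glue_liftP u; have [w Ew Ev] := glue_liftP v.
    have tauv := tau_glue (glue_valP v).
    rewrite (@glue_liftE _ (z * (glue_val v).1 + rho (glue_val u).2 * w)) /=.
      rewrite rmorphM raddfD /= (tran_additive T_tam) !rmorphM /=.
      rewrite -Ev1 (frobenius_reciprocity T_tam) -res_g [_ * f w]mulrC.
      by rewrite (frobenius_reciprocity T_tam) Eu Ev; ring.
    have Er : rho (glue_val v).2 = (glue_val v).1 - (w + tau w).
      by rewrite Ew addrK.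
    by rewrite !rmorphM raddfD /= !rmorphM tauv gd_tau_res Ez Er; ring.
- exact: f_tau.
- by move=> u; rewrite res_glue_lift.
- by move=> a; rewrite (@glue_liftE _ a) /= raddf0 add0r.
- by move=> a; have [z Ez ->] := norm_f a; rewrite (@glue_liftE _ z).
Qed.
End GlueMorphism.

(** * The torsion-free cover of a Tambara functor *)

Section UnitalMonoid.
Variable R : comPzRingType.

(** The multiplicative monoid of [R] with a new unit adjoined.  In a monoid of
monomials only the unit divides the unit, which fails in general for [R] itself;
adjoining [None] enforces this, and every multiplicative map still extends. *)
Definition mon : Type := option R.
HB.instance Definition _ := Choice.on mon.

Definition mon_mul (x y : mon) : mon :=
  if x is Some a then if y is Some b then Some (a * b) else x else y.

Fact mon_mulA : associative mon_mul.
Proof. by case=> [a|] [b|] [c|] //=; rewrite mulrA. Qed.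
Fact mon_mulC : commutative mon_mul.
Proof. by case=> [a|] [b|] //=; rewrite mulrC. Qed.
Fact mon_mul1 : left_id None mon_mul.
Proof. by []. Qed.
Fact mon_mulr1 : right_id None mon_mul.
Proof. by case. Qed.
Fact mon_mul_eq1 x y : mon_mul x y = None -> x = None /\ y = None.
Proof. by case: x y => [a|] [b|]. Qed.

HB.instance Definition _ := Choice_isMonomialDef.Build mon
  mon_mulA mon_mul1 mon_mulr1 mon_mul_eq1.
HB.instance Definition _ := MonomialDef_isConomialDef.Build mon mon_mulC.

Definition mon_val (x : mon) : R := if x is Some a then a else 1.

Lemma mon_valM x y : mon_val (mmul x y) = mon_val x * mon_val y.
Proof. by case: x y => [a|] [b|]; rewrite /= ?mul1r ?mulr1. Qed.

Definition mon_ring : comPzRingType := {malg int[mon]}.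

End UnitalMonoid.

Definition mon_map (R S : comPzRingType) (f : R -> S) : mon R -> mon S :=
  omap f.

Lemma mon_mapM (R S : comPzRingType) (f : R -> S) :
  {morph f : a b / a * b} ->
  forall x y, mon_map f (mmul x y) = mmul (mon_map f x) (mon_map f y).
Proof. by move=> fM [a|] [b|]; rewrite /= ?fM. Qed.

Lemma mon_eval_rmorphism (R : comPzRingType) :
  is_rmorphism (zlift (@mon_val R) : mon_ring R -> R).
Proof. by apply: zlift_rmorphism => //; apply: mon_valM. Qed.

Definition mon_eval (R : comPzRingType) : {rmorphism mon_ring R -> R} :=
  rmorph_of (mon_eval_rmorphism R).

Lemma mon_evalU (R : comPzRingType) k : @mon_eval R << k >> = mon_val k.
Proof. exact: zliftU. Qed.

(* Simplification would otherwise unfold the morphism to a bare linear extension,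
   hiding its multiplicativity from [rmorphM]. *)
Opaque mon_eval.

Section MonRingMap.
Variables (R S : comPzRingType) (f : R -> S).
Hypothesis fM : {morph f : a b / a * b}.

Lemma mon_ring_map_rmorphism :
  is_rmorphism (zlift (fun k => << mon_map f k >>) : mon_ring R -> mon_ring S).
Proof.
by apply: zlift_rmorphism => // x y; rewrite mon_mapM // malgUM.
Qed.

Definition mon_ring_map : {rmorphism mon_ring R -> mon_ring S} :=
  rmorph_of mon_ring_map_rmorphism.

Lemma mon_ring_mapU k : mon_ring_map << k >> = << mon_map f k >>.
Proof. exact: zliftU. Qed.

End MonRingMap.
Opaque mon_ring_map.

Section Cover.
Variable T : tambara.
Local Notation T_tam := (t_axioms T).
Local Notation A := (t_und T).
Local Notation B := (t_fix T).
Let tauM : {morph t_tau T : a b / a * b} := (tau_rmorphism T_tam).2.2.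
Let resM : {morph t_res T : a b / a * b} := (res_rmorphism T_tam).2.2.

Local Notation tau := (mon_ring_map tauM).
Local Notation rho := (mon_ring_map resM).
Local Notation nu := (mon_ring_map (norm_mult T_tam)).

Fact cover_tauK : involutive tau.
Proof.
apply: (@eq_malgZ _ _ (tau \o tau) id) => [x y||k] //=.
  by rewrite !raddfB.
rewrite !mon_ring_mapU; case: k => [a|] //=.
by rewrite (tau_involutive T_tam).
Qed.

Fact cover_tau_res y : tau (rho y) = rho y.
Proof.
move: y; apply: (@eq_malgZ _ _ (tau \o rho) rho) => [x y|x y|k] /=.
- by rewrite !raddfB.
- by rewrite !raddfB.
- by rewrite !mon_ring_mapU; case: k => [a|] //=; rewrite (tau_res T_tam).
Qed.

Fact cover_norm_tau a : nu (tau a) = nu a.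
Proof.
move: a; apply: (@eq_malgZ _ _ (nu \o tau) nu) => [x y|x y|k] /=.
- by rewrite !raddfB.
- by rewrite !raddfB.
- by rewrite !mon_ring_mapU; case: k => [a|] //=; rewrite (norm_tau T_tam).
Qed.

Fact cover_eval_tau a : mon_eval A (tau a) = t_tau T (mon_eval A a).
Proof.
have [tauB [tau1 _]] := tau_rmorphism T_tam.
move: a; apply: (@eq_malgZ _ _ (mon_eval A \o tau) (t_tau T \o mon_eval A))
  => [x y|x y|k] /=.
- by rewrite !raddfB.
- by rewrite raddfB tauB.
- by rewrite mon_ring_mapU !mon_evalU; case: k => [a|] //=; rewrite tau1.
Qed.

Fact cover_res_eval y : t_res T (mon_eval B y) = mon_eval A (rho y).
Proof.
have [resB [res1 _]] := res_rmorphism T_tam.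
move: y; apply: (@eq_malgZ _ _ (t_res T \o mon_eval B) (mon_eval A \o rho))
  => [x y|x y|k] /=.
- by rewrite raddfB resB.
- by rewrite !raddfB.
- by rewrite mon_ring_mapU !mon_evalU; case: k => [b|] //=; rewrite res1.
Qed.

(** [a * tau a] and [rho (nu a)] differ by a trace: they agree on a generator, and
the mixed terms of a product of sums pair up under [tau].  The same [z] corrects the
norm of [T], so both statements are proved with a common witness. *)
Fact cover_norm_eval a : exists2 z,
  a * tau a = rho (nu a) + (z + tau z) &
  t_norm T (mon_eval A a) = mon_eval B (nu a) + t_tran T (mon_eval A z).
Proof.
elim/malgZ_ind: a => [|k|x y [z Ez Nz] [w Ew Nw]].
- exists 0; rewrite !raddf0 ?mul0r ?addr0 //.
  by rewrite (norm0 T_tam) (tran0 T_tam) addr0.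
- exists 0; rewrite ?raddf0 ?addr0.
    rewrite !mon_ring_mapU -malgUM; case: k => [c|] //=.
    by rewrite (res_norm T_tam).
  rewrite !mon_ring_mapU !mon_evalU (tran0 T_tam) addr0.
  by case: k => [c|] //=; rewrite (norm1 T_tam).
  (* [y * tau y - w] is the witness for [- y], from the sign rule for the norm, and
     [- x * tau y] accounts for the mixed terms. *)
- exists (z + (y * tau y - w) - x * tau y).
    have Er : rho (nu x) = x * tau x - (z + tau z) by rewrite Ez addrK.
    have Er' : rho (nu y) = y * tau y - (w + tau w) by rewrite Ew addrK.
    rewrite !(raddfB, raddfD) /= !(rmorphM tau) /= !cover_tauK Er Er'; ring.
  rewrite !raddfB /= (norm_add T_tam) (norm_opp T_tam) Nz Nw.
  rewrite (is_rmorphismN (tau_rmorphism T_tam)) mulrN (tranN T_tam).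
  rewrite !(raddfB, raddfD, rmorphM) /= !rmorphM /= !cover_eval_tau.
  by rewrite !(tran_zmod_morphism T_tam, tran_additive T_tam); ring.
Qed.

(** A choice of one element in each [tau]-orbit: [choose] depends on the predicate
only, and this is the same for the two elements of an orbit. *)
Definition orbit_rep (k : mon A) : mon A :=
  choose (pred2 k (mon_map (t_tau T) k)) k.

Fact orbit_rep_tau k : orbit_rep (mon_map (t_tau T) k) = orbit_rep k.
Proof.
have tauK : mon_map (t_tau T) (mon_map (t_tau T) k) = k.
  by case: k => [a|] //=; rewrite (tau_involutive T_tam).
rewrite /orbit_rep tauK (@eq_choose _ _ (pred2 k (mon_map (t_tau T) k))).
  by apply: choose_id; rewrite /= eqxx ?orbT.
by move=> l; rewrite /= orbC.
Qed.

Fact tran_orbit_rep k :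
  t_tran T (mon_val (orbit_rep k)) = t_tran T (mon_val k).
Proof.
have /orP[/eqP->|/eqP->] //: pred2 k (mon_map (t_tau T) k) (orbit_rep k).
  by apply: (@chooseP _ (pred2 k _)); rewrite /= eqxx.
have [_ [tau1 _]] := tau_rmorphism T_tam.
by case: k => [a|] //=; rewrite (tran_tau T_tam).
Qed.

(** Replacing each generator by its orbit representative, [rep], does not change
the transfer, and it identifies [z] with [tau z]: from [z + tau z = 0] it follows
that [2 rep z = 0], hence [rep z = 0] as there is no torsion. *)
Fact cover_tran_eval_eq0 z : z + tau z = 0 -> t_tran T (mon_eval A z) = 0.
Proof.
pose rep : mon_ring A -> mon_ring A := zlift (fun k => << orbit_rep k >>).
have repB : zmod_morphism rep by apply: zlift_is_zmod_morphism.
have rep_tau x : rep (tau x) = rep x.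
  move: x; apply: (@eq_malgZ _ _ (rep \o tau) rep) => [x y|//|k] /=.
    by rewrite raddfB repB.
  by rewrite mon_ring_mapU /rep !zliftU orbit_rep_tau.
have tran_rep x : t_tran T (mon_eval A (rep x)) = t_tran T (mon_eval A x).
  move: x; apply: (@eq_malgZ _ _ (t_tran T \o mon_eval A \o rep)
    (t_tran T \o mon_eval A)) => [x y|x y|k] /=.
  - by rewrite repB raddfB (tran_zmod_morphism T_tam).
  - by rewrite raddfB (tran_zmod_morphism T_tam).
  - by rewrite /rep zliftU !mon_evalU tran_orbit_rep.
have repD : {morph rep : x y / x + y}.
  exact: (raddfD (zlift (fun k => << orbit_rep k >>))).
have rep0 : rep 0 = 0 by exact: (raddf0 (zlift (fun k => << orbit_rep k >>))).
move=> trz0; have /malgZ_torsion_free rz0 : rep z *+ 2 = 0.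
  by rewrite mulr2n -{2}rep_tau -repD trz0 rep0.
by rewrite -tran_rep rz0 // raddf0 (tran0 T_tam).
Qed.

Definition cover_datum : geometric_datum :=
  GeometricDatum cover_tauK cover_tau_res cover_norm_tau
    (fun a => let: ex_intro2 z Ez _ := cover_norm_eval a in ex_intro _ z Ez).

(** The Burnside-type Tambara functor on the multiplicative monoids of [T]: the left
adjoint of forgetting addition and transfer, applied to them. *)
Definition cover : tambara := glue_tambara cover_datum.

Definition cover_und : t_und cover -> A := mon_eval A.
Definition cover_fix : t_fix cover -> B :=
  @glue_lift cover_datum T (mon_eval A) (mon_eval B).

Lemma cover_morphism : is_tambara_morphism cover T cover_und cover_fix.
Proof.
apply: glue_lift_morphism.
- exact: cover_eval_tau.
- exact: cover_res_eval.
- exact: cover_tran_eval_eq0.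
- exact: cover_norm_eval.
Qed.

Lemma cover_und_surjective a : exists x, cover_und x = a.
Proof. by exists << Some a : mon A >>; apply: mon_evalU. Qed.

Lemma cover_fix_surjective b : exists u, cover_fix u = b.
Proof.
have Gb : (rho << Some b : mon B >>, << Some b : mon B >>) \in
    @glue_pred cover_datum.
  by apply/glue_predP; exists 0; rewrite /= !raddf0 !addr0.
exists (Glue Gb).
rewrite /cover_fix (@glue_liftE cover_datum _ _ _ cover_tran_eval_eq0 _ 0).
- by rewrite raddf0 (tran0 T_tam) addr0 mon_evalU.
- by rewrite /= !raddf0 !addr0.
Qed.

Lemma cover_und_torsion_free : torsion_free (t_und cover).
Proof. exact: malgZ_torsion_free. Qed.

Lemma cover_fix_torsion_free : torsion_free (t_fix cover).
Proof.
move=> n u n_gt0 un0; apply: val_inj.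
have val0 : val u *+ n = 0 by rewrite -raddfMn un0 raddf0.
have fst0 : (val u).1 *+ n = 0 by rewrite -(raddfMn fst) val0.
have snd0 : (val u).2 *+ n = 0 by rewrite -(raddfMn snd) val0.
rewrite raddf0 [LHS]surjective_pairing.
by congr (_, _); apply: malgZ_torsion_free n_gt0 _.
Qed.
End Cover.

(** * Ghost maps *)

Section Ghost.
Variables (p : nat) (m : option nat).

Lemma ghost_natural (A B : comPzRingType) (f : A -> B) (a : vec m A) :
  is_rmorphism f -> ghost p (vmap m f a) = vmap m f (ghost p a).
Proof.
move=> f_rm; apply: funext => j; rewrite /ghost /vmap /=.
rewrite (big_morph f (is_rmorphismD f_rm) (is_rmorphism0 f_rm)).
by apply: eq_bigr => i _; rewrite (is_rmorphismMn f_rm) (is_rmorphismX f_rm).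
Qed.

(** The ghost component of index [j] is [p ^ j] times the coordinate of index [j]
plus an expression in the lower coordinates, so the coordinates are recovered
one after the other by cancelling powers of [p]. *)
Lemma ghost_injective (A : comPzRingType) :
  (0 < p)%N -> torsion_free A -> injective (@ghost p m A).
Proof.
move=> p_gt0 tfA a b Eab; apply: funext => j.
have [n] := ubnP (val j); elim: n j => // n IH j /ltnSE le_jn.
have /eqP := congr1 (fun g : vec m A => g j) Eab; rewrite /ghost.
(* The indices in range form an initial segment, so [insubd] does not fall back on
   its default. *)
have insub_low (i : nat) : (i < val j)%N -> val (insubd j i) = i.
  move=> lt_ij; rewrite val_insubd.
  case: j lt_ij {le_jn IH} => j /=; case: m => [k|//] /= lt_jk lt_ij.
  by rewrite (ltn_trans lt_ij).
rewrite !big_ord_recr /= valKd subnn expn0 !expr1.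
rewrite (eq_bigr (fun i : 'I_(val j) =>
  b (insubd j (i : nat)) ^+ (p ^ (val j - i)) *+ p ^ i)); last first.
  move=> i _; rewrite IH // insub_low //.
  exact: leq_trans (ltn_ord i) le_jn.
rewrite (can_eq (addKr _)) -subr_eq0 -mulrnBl => /eqP/tfA /eqP.
by rewrite subr_eq0 expn_gt0 p_gt0 => /(_ isT)/eqP.
Qed.
End Ghost.

(** * Witt vectors of a Tambara functor *)

Section WittTambara.
Variables (p : nat) (m : option nat).
Variables (W : witt_structure p m) (P : witt_poly_functoriality W).
Hypothesis p_gt2 : (2 < p)%N.

Lemma witt_map_surjective (A B : comPzRingType) (f : A -> B) :
  (forall b, exists a, f a = b) ->
  forall y : witt W B, exists x : witt W A, witt_map f x = y.
Proof.
move=> f_surj y; exists (fun j => sval (cid (f_surj (y j)))).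
by apply: funext => j; apply: (svalP (cid (f_surj (y j)))).
Qed.

(** The formula defining the transfer on Witt vectors holds in every Tambara
functor ([tran_norm]), in particular in the product of copies of [T]; so the
transfer is respected because the norm and the ring operations are. *)
Lemma witt_ghost_morphism (T : tambara) :
  is_tambara_morphism (witt_tambara P T) (tambara_prod m T)
    (@witt_w p m W (t_und T)) (@witt_w p m W (t_fix T)).
Proof.
have T_tam := t_axioms T.
have norm_ghost x : @witt_w p m W _ (wpoly P (t_norm T) x) =
    t_norm (tambara_prod m T) (@witt_w p m W _ x).
  exact: (wpoly_ghost P p_gt2 (norm_mult_polynomial T_tam) x).
have wB (x y : witt W (t_fix T)) : witt_w (x - y) = witt_w x - witt_w y.
  exact: ((witt_ghost W (t_fix T)).1 x y).
have w1 : @witt_w p m W (t_fix T) 1 = 1 by exact: (witt_ghost W _).2.1.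
have wS (x : witt W (t_und T)) : witt_w (x + 1) = witt_w x + 1.
  rewrite -[1 in RHS](witt_ghost W (t_und T)).2.1.
  exact: (is_rmorphismD (witt_ghost W _)).
split.
- exact: witt_ghost.
- exact: witt_ghost.
- by move=> x; apply: ghost_natural (tau_rmorphism T_tam).
- by move=> x; apply: ghost_natural (res_rmorphism T_tam).
- move=> x; rewrite (tran_norm (t_axioms (tambara_prod m T))).
  by rewrite -wS -!norm_ghost -w1 -!wB.
- exact: norm_ghost.
Qed.

(** The norm is natural because [g \o t_norm T] and [t_norm T' \o f] are the same
map, of degree at most 2, and [wpoly] is functorial on either composite. *)
Lemma witt_map_morphism (T T' : tambara)
    (f : t_und T -> t_und T') (g : t_fix T -> t_fix T') :
  is_tambara_morphism T T' f g ->
  is_tambara_morphism (witt_tambara P T) (witt_tambara P T')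
    (witt_map f) (witt_map g).
Proof.
case=> f_rm g_rm ftau fres gtran gnorm.
have p_gt1 : (1 < p)%N by apply: ltn_trans p_gt2.
have Wf := witt_natural W f_rm; have Wg := witt_natural W g_rm.
have norm_map x : witt_map g (wpoly P (t_norm T) x) =
    wpoly P (t_norm T') (witt_map f x).
  have NT := norm_mult_polynomial (t_axioms T).
  have NT' := norm_mult_polynomial (t_axioms T').
  rewrite -(wpoly_rmorphism P g_rm) -(wpoly_rmorphism P f_rm).
  have := wpoly_comp P p_gt2 p_gt1 p_gt2 NT (rmorphism_mult_polynomial g_rm) x.
  have := wpoly_comp P p_gt1 p_gt2 p_gt2 (rmorphism_mult_polynomial f_rm) NT' x.
  by rewrite /= => <- <-; congr (wpoly P _ x); apply: funext => a; apply: gnorm.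
have gB (x y : witt W (t_fix T)) :
  witt_map g (x - y) = witt_map g x - witt_map g y by exact: (Wg.1 x y).
have g1 : witt_map g (1 : witt W (t_fix T)) = 1 by exact: Wg.2.1.
have fS (x : witt W (t_und T)) : witt_map f (x + 1) = witt_map f x + 1.
  by rewrite -[1 in RHS]Wf.2.1; apply: (is_rmorphismD Wf).
split.
- exact: Wf.
- exact: Wg.
- by move=> x; apply: funext => j; apply: ftau.
- by move=> x; apply: funext => j; apply: fres.
- by move=> x /=; rewrite -fS -!norm_map -g1 -!gB.
- exact: norm_map.
Qed.

Lemma witt_is_tambara_torsion_free (T : tambara) :
  torsion_free (t_und T) -> torsion_free (t_fix T) ->
  is_tambara (witt_tambara P T).
Proof.
move=> tfA tfB; have p_gt0 : (0 < p)%N by apply: ltn_trans p_gt2.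
apply: tambara_of_injective (witt_ghost_morphism T) _ _ (t_axioms _).
- exact: ghost_injective.
- exact: ghost_injective.
Qed.

Lemma witt_is_tambara (T : tambara) : is_tambara (witt_tambara P T).
Proof.
apply: tambara_of_surjective (witt_map_morphism (cover_morphism T)) _ _ _.
- exact/witt_map_surjective/cover_und_surjective.
- exact/witt_map_surjective/cover_fix_surjective.
- apply: witt_is_tambara_torsion_free.
  + exact: cover_und_torsion_free.
  + exact: cover_fix_torsion_free.
Qed.

Lemma witt_is_ghost_functor : is_ghost_functor (witt_tambara P).
Proof.
split.
- exact: witt_is_tambara.
- exact: witt_map_morphism.
- exact: witt_ghost_morphism.
- by move=> T T' f g [f_rm g_rm _ _ _ _]; split=> x; apply: ghost_natural.
Qed.

End WittTambara.

(** The injective ghost maps determine the structure on the cover of [T], and the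
surjection from the cover determines it on [T]. *)
Lemma ghost_functor_unique (p : nat) (m : option nat) (W : witt_structure p m)
    (F G : forall T : tambara,
       tambara_ops (witt W (t_und T)) (witt W (t_fix T))) :
  (0 < p)%N -> is_ghost_functor F -> is_ghost_functor G ->
  forall T, F T = G T.
Proof.
move=> p_gt0 FP GP T.
have cov := cover_morphism T.
have EFG : F (cover T) = G (cover T).
  apply: ops_eq_of_injective (gf_ghost FP _) (gf_ghost GP _) _ _.
  - exact/ghost_injective/cover_und_torsion_free.
  - exact/ghost_injective/cover_fix_torsion_free.
have Fcov := gf_functorial FP cov.
rewrite EFG in Fcov.
apply: ops_eq_of_surjective Fcov (gf_functorial GP cov) _ _.
- exact/witt_map_surjective/cover_und_surjective.
- exact/witt_map_surjective/cover_fix_surjective.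
Qed.

Theorem theoremC :
  forall (p : nat) (m : option nat)
    (p_prime : prime p) (p_odd : odd p) (m_pos : m <> Some 0%N)
    (W : witt_structure p m) (P : witt_poly_functoriality W),
    (forall T : tambara, is_tambara (witt_tambara P T)) /\
    is_ghost_functor (witt_tambara P) /\
    (forall F : forall T : tambara,
         tambara_ops (witt W (t_und T)) (witt W (t_fix T)),
       is_ghost_functor F ->
       forall T : tambara, F T = witt_tambara P T).
Proof.
move=> p m p_prime p_odd _ W P.
have p_gt2 := odd_prime_gt2 p_odd p_prime.
have WP := witt_is_ghost_functor P p_gt2.
split; first exact: witt_is_tambara.
split=> // F FP; exact: ghost_functor_unique (prime_gt0 p_prime) FP WP.
Qed.
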